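(* For $n\ge1$, the Narayana polynomials of types $A$ and $B$ have the following expansions: $$(n+1)!\,N(A_{n-1},x)=\sum_{T\in\mathrm{SYT}(n)}\left(\prod_{i=1}^n\sigma_i(T)\right)\left(\prod_{i=1}^n\Bigl(i!\sum_{j\ge0}\binom{i+1}{2j-i}x^{j-\frac i2}\Bigr)^{w_i(T)}\right)x^{\frac n2-\ell(\lambda(T))},$$ $$n!\,N(B_n,x)=\sum_{T\in\mathrm{SYT}(n)}\left(\prod_{i=1}^n\delta_i(T)\,c_i^{w_i(T)}\right)x^{\frac n2-\frac12\ell(\lambda(T))},$$ where $c_{2i-1}=4^{i-1}(x+1)$ and $c_{2i}=4^i\sqrt x$ for $i\ge1$, $\sigma_i(T)$ is the box sorting index and $\delta_i(T)$ is the second-order box sorting index.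
   Context: $N(A_{n-1},x)=\sum_{k=0}^{n-1}\frac1n\binom n{k+1}\binom nk x^k$ and $N(B_n,x)=\sum_{k=0}^n\binom nk^2x^k$. Binomial coefficients $\binom{m}{r}$ with $r<0$ or $r>m$ are $0$. A standard Young tableau of size $n$ is a filling of the Ferrers diagram of a partition $\lambda\vdash n$ (French convention: left-justified rows numbered from bottom to top, $\lambda_i$ boxes in row $i$) with $1,\dots,n$, each used exactly once, increasing from left to right in rows and from bottom to top in columns; $\mathrm{SYT}(n)$ is the set of all of them, over all $\lambda\vdash n$. For $T\in\mathrm{SYT}(n)$, $\ell(\lambda(T))$ is the number of rows of $T$, $w_i(T)$ is the number of rows of $T$ with exactly $i$ boxes, $T_i$ is the tableau obtained from $T$ by deleting the entries $i+1,\dots,n$, and $\mathrm{col}_k(T_i)$ is the number of boxes in the $k$-th column of $T_i$. If $i$ is in the first column of $T$, then $$\sigma_i(T)=i-\mathrm{col}_1(T_i)+1,\qquad \delta_i(T)=2i-\mathrm{col}_1(T_i);$$ if $i$ is in the $(k+1)$-th column of $T$ with $k\ge1$, then $\sigma_i(T)=\delta_i(T)=\mathrm{col}_k(T_i)-\mathrm{col}_{k+1}(T_i)+1$. *)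

(* Defs.v *)
From HB Require Import structures.
From mathcomp Require Import all_boot all_algebra.

Set Implicit Arguments.
Unset Strict Implicit.
Unset Printing Implicit Defensive.

Import GRing.Theory.

(* A tableau is the sequence of its rows, listed from bottom to top (French   *)
(* convention), each row being read from left to right.  Rows and columns are *)
(* numbered from 1 and the entries are 1, .., n.                              *)
Definition tableau := seq (seq nat).

Definition shape (T : tableau) : seq nat := [seq size r | r <- T].

(* The k-th column (k >= 1), read from bottom to top. *)
Definition column (k : nat) (T : tableau) : seq nat :=
  [seq nth 0 r k.-1 | r <- T & k <= size r].

Definition is_partition (n : nat) (la : seq nat) : bool :=
  [&& sorted geq la, 0 \notin la & sumn la == n].

(* A tableau with n boxes has at most n columns. *)
Definition is_syt (n : nat) (T : tableau) : bool :=
  [&& is_partition n (shape T),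
      perm_eq (flatten T) (iota 1 n),
      all (sorted ltn) T
    & all (fun k => sorted ltn (column k T)) (iota 1 n)].

Record SYT (n : nat) := MkSYT {
  rows_of :> tableau;
  rows_ofP : is_syt n rows_of
}.

HB.instance Definition _ n := [isSub for @rows_of n].
HB.instance Definition _ n := [Countable of SYT n by <:].

Section Finite.
Variable n : nat.

Let enc (T : SYT n) : n.-bseq (n.-bseq 'I_n.+1) :=
  insub_bseq n [seq insub_bseq n [seq inord e | e <- r] | r <- rows_of T].

Let dec (t : n.-bseq (n.-bseq 'I_n.+1)) : option (SYT n) :=
  insub [seq [seq val e | e <- bseqval r] | r <- bseqval t].

Lemma size_insub_bseq_id m (A : Type) (s : seq A) :
  size s <= m -> insub_bseq m s = s :> seq A.
Proof. by move=> les; rewrite /insub_bseq insubdK. Qed.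

Fact SYT_encK : pcancel enc dec.
Proof.
case=> T; rewrite /dec /enc /= => TP.
have [/and3P [_ sh0 /eqP shn] fl _ _] := and4P TP.
have leT r : r \in T -> size r <= n.
  move=> rT; rewrite -shn /shape; elim: (T) rT => //= r' T' IH.
  rewrite in_cons => /predU1P [->|/IH h]; first exact: leq_addr.
  exact: leq_trans h (leq_addl _ _).
have lenT : size T <= n.
  rewrite -shn -(size_map size) -/(shape T).
  elim: (shape T) sh0 => //= a s IH; rewrite in_cons negb_or => /andP [a0 /IH h].
  by case: a a0 => // a _; rewrite addSn ltnS (leq_trans h) ?leq_addl.
rewrite size_insub_bseq_id ?size_map // -map_comp.
rewrite [X in insub X](_ : _ = T) ?insubT //.
rewrite -[RHS]map_id; apply/eq_in_map => r rT /=.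
rewrite size_insub_bseq_id ?size_map ?leT // -map_comp -[RHS]map_id.
apply/eq_in_map => e er /=; rewrite inordK //.
have : e \in flatten T by apply/flattenP; exists r.
by rewrite (perm_mem fl) mem_iota add1n => /andP [].
Qed.

HB.instance Definition _ : isFinite (SYT n) := PCanIsFinite SYT_encK.

End Finite.

(* T_i: the entries larger than i are deleted, together with the rows that    *)
(* become empty.                                                              *)
Definition restr (T : tableau) (i : nat) : tableau :=
  [seq r <- [seq [seq e <- r | e <= i] | r <- T] | r != [::]].

Definition col (k : nat) (T : tableau) : nat := size (column k T).

Definition nb_rows (T : tableau) : nat := size T.

Definition w (i : nat) (T : tableau) : nat := count_mem i (shape T).

Definition row_with (T : tableau) (i : nat) : seq nat :=
  nth [::] T (find (fun r => i \in r) T).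

(* The number (>= 1) of the column containing the entry i. *)
Definition col_of (T : tableau) (i : nat) : nat := (index i (row_with T i)).+1.

(* The truncated subtractions below are exact for 1 <= i <= n and T in SYT(n):*)
(* T_i has i boxes and its column heights are weakly decreasing.              *)
Definition sigma (T : tableau) (i : nat) : nat :=
  if col_of T i == 1 then i - col 1 (restr T i) + 1
  else let k := (col_of T i).-1 in
    col k (restr T i) - col k.+1 (restr T i) + 1.

Definition delta (T : tableau) (i : nat) : nat :=
  if col_of T i == 1 then 2 * i - col 1 (restr T i)
  else let k := (col_of T i).-1 in
    col k (restr T i) - col k.+1 (restr T i) + 1.

Local Open Scope ring_scope.

(* Binomial coefficients with an integer lower index. *)
Definition binz (m : nat) (r : int) : nat :=
  if r is Posz k then 'C(m, k) else 0%N.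

(* The polynomial N(A_{n-1}, x), for n >= 1. *)
Definition narayanaA (F : fieldType) (n : nat) : {poly F} :=
  \sum_(k < n) (n%:R^-1 * 'C(n, k.+1)%:R * 'C(n, k)%:R) *: 'X^k.

Definition narayanaB (F : fieldType) (n : nat) : {poly F} :=
  \sum_(k < n.+1) ('C(n, k)%:R ^+ 2) *: 'X^k.

(* Here y is a square root of x, so that x^(m/2) is y ^ m for every integer   *)
(* m.  The sum over j >= 0 stops at j = i since binz i.+1 (2j - i) = 0 for    *)
(* j > i.                                                                     *)
Definition factorA (F : fieldType) (y : F) (i : nat) : F :=
  i`!%:R * \sum_(j < i.+1)
    (binz i.+1 ((2 * j)%N%:Z - i%:Z))%:R * y ^ ((2 * j)%N%:Z - i%:Z).

(* c_i, with odd and even indices treated together: c_{2m-1} =                *)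
(* 4^(m-1) (x+1) and c_{2m} = 4^m sqrt x, where y = sqrt x.                   *)
Definition factorB (F : fieldType) (x y : F) (i : nat) : F :=
  if odd i then 4 ^+ i./2 * (x + 1) else 4 ^+ i./2 * y.

(* Main.v *)
From HB Require Import structures.
Require Import Defs.
From mathcomp Require Import all_boot all_algebra.
From mathcomp Require Import zify ring.
From mathcomp.multinomials Require Import mpoly.

Set Implicit Arguments.
Unset Strict Implicit.
Unset Printing Implicit Defensive.

Import GRing.Theory.

(** Both identities evaluate an iterated derivation in two ways.

    Let D be a derivation of a commutative ring and g_0, g_1, ... elements
    with D g_i = g_0^m g_{i+1}.  Applied to a monomial g_0^a g_{k_1} ... g_{k_l},
    D raises one index by one and multiplies by g_0^m.  If k_1, ..., k_l are the
    row lengths of a tableau, raising an index k >= 1 appends a box to a row of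
    length k, in as many ways as there are such rows, and raising an index 0
    opens a new row, in as many ways as the exponent a says.  By induction
      D^n g_0 = sum over T in SYT(n) of
                wt(T) * g_0^(m n + 1 - l(T)) * prod of g_k over the rows of T,
    where wt(T) is the product of these numbers of ways (iter_tower).  They are
    the sigma_i(T) when m = 1 and the delta_i(T) when m = 2.

    It remains to find a ring, a derivation and two such towers whose values
    at some point are the weights of the theorem.  One polynomial vector field
    in two variables serves both:
      D eta = eta^2 del^3,   D del = x eta^3 del^2,   at eta = del = 1.
    Put G = eta del and h = del^2 + x eta^2.  Then D G = h G^2,
    D h = 4 x G^3, and h^2 - 4 x G^2 = (del^2 - x eta^2)^2 is constant along D.
    - Type B, m = 2: the tower starting at G alternates between multiples of G
      and h, with values (4x)^j and (4x)^j (1 + x)  (flow_towerB).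
    - Type A, m = 1: the tower starts at eta^2.  With A = (y eta + del) del and
      B = (y eta - del) del, both solutions of D f = y eta^2 f^2, its i-th term
      for i >= 1 is a multiple of A^(i+1) - B^(i+1), whose value
      (y+1)^(i+1) - (y-1)^(i+1) is twice the parity-restricted binomial sum of
      the theorem  (flow_towerA, factorAE).

    Analytically, G is the generating series 1 / sqrt(1 - 2(1+x)u + (1-x)^2 u^2)
    of the N(B_n, x) in the time u of the flow, and eta^2 is the derivative of
    u + sum over n >= 1 of N(A_{n-1}, x) u^(n+1).  This is established by
    recurrences rather than by series: the constancy of h^2 - 4 x G^2 gives a
    three-term recurrence for D^n G and D^n eta^2 (three_term), and the Narayana
    polynomials satisfy the same one (narayanaB_rec, narayanaA_rec). *)

Local Notation shape := Defs.shape.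
Local Notation col := Defs.col.

(** * Growing a tableau by its largest entry *)

(** Inserts [e] at the end of the lowest row of length [k], or as a new top row
    when there is none.  As row lengths weakly decrease upwards, the corners where a
    standard tableau can grow are in bijection with the distinct row lengths,
    together with 0 for a new row.  Indexing insertions by [k] instead of a
    position makes the number of rows of length [k] the weight of the step. *)
Fixpoint grow (k e : nat) (T : tableau) : tableau :=
  if T is r :: T' then
    if size r == k then rcons r e :: T' else r :: grow k e T'
  else [:: [:: e]].

Definition ends (T : tableau) : seq nat := 0 :: undup (shape T).

Lemma mem_ends T k : (k \in ends T) = (k \in 0 :: shape T).
Proof. by rewrite !inE mem_undup. Qed.

Lemma path_geq_le (x k : nat) s : path geq x s -> k \in 0 :: s -> k <= x.
Proof.
move=> + /predU1P[->//|]; rewrite path_sortedE; last by move=> a b c /=; lia.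
by case/andP=> /allP h _ /h.
Qed.

Lemma path_geqW (x z : nat) s : x <= z -> path geq x s -> path geq z s.
Proof. by case: s => //= a s xz /andP[ax ->]; rewrite (leq_trans ax xz). Qed.

Lemma ends_behead k (r : seq nat) (T : tableau) : size r != k ->
  k \in 0 :: shape (r :: T) -> k \in 0 :: shape T.
Proof. by rewrite !inE eq_sym => /negPf->. Qed.

Lemma shape_grow_path x k e T : path geq x (shape T) -> k < x ->
  k \in 0 :: shape T -> path geq x (shape (grow k e T)).
Proof.
elim: T x => [|r T IH] x /=.
  by move=> _ kx; rewrite inE => /eqP k0; rewrite andbT; lia.
case/andP=> rx rT kx; case: eqP => [rk _|/eqP rk kT] /=.
  by rewrite size_rcons rk kx /= (path_geqW _ rT) ?rk.
have kT' := ends_behead rk kT.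
rewrite rx /= IH //.
by have := path_geq_le rT kT'; move: rk; lia.
Qed.

Lemma shape_grow k e T : sorted geq (shape T) -> k \in 0 :: shape T ->
  sorted geq (shape (grow k e T)).
Proof.
move=> sT kT; apply: (@path_sorted _ _ (head 0 (shape T) + k.+1)).
apply: shape_grow_path => //; last by rewrite addnS ltnS leq_addl.
by case: (T) sT => //= r T' ->; rewrite leq_addr.
Qed.

Lemma flatten_grow k e T : perm_eq (flatten (grow k e T)) (e :: flatten T).
Proof.
elim: T => //= r T IH; case: eqP => _ /=.
  by rewrite cat_rcons -cat1s perm_catCA.
apply: (@perm_trans _ (r ++ e :: flatten T)); first by rewrite perm_cat2l.
by rewrite -(cat1s e (flatten T)) -[X in perm_eq _ X]cat1s perm_catCA.
Qed.

Lemma column_cons j r T :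
  column j (r :: T) = (if j <= size r then [:: nth 0 r j.-1] else [::]) ++ column j T.
Proof. by rewrite /column /=; case: leqP. Qed.

Lemma column_nil j T : all (fun a => a < j) (shape T) -> column j T = [::].
Proof. by elim: T => //= r T IH /andP[rj /IH]; rewrite column_cons leqNgt rj. Qed.

(** Only column [k.+1] changes: the rows below the new box are longer than [k] and
    contribute to it, the rows above have at most [k] boxes and do not, so
    that the new entry is its last one. *)
Lemma column_grow j k e T : 0 < j -> sorted geq (shape T) -> k \in 0 :: shape T ->
  column j (grow k e T) =
  if j == k.+1 then rcons (column j T) e else column j T.
Proof.
move=> j0; elim: T => [_|r T IH pT kT] /=.
  rewrite inE => /eqP->; rewrite column_cons /=.
  by case: (ltngtP j 1) => //; [lia|move->].
have gT : transitive geq by move=> a b c /=; lia.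
have := pT; rewrite /= path_sortedE // => /andP[/allP rT sT].
case: eqP => [rk|/eqP rk].
  rewrite !column_cons size_rcons nth_rcons rk.
  case: (ltngtP j k.+1) => jk.
  - by move: jk; rewrite ltnS prednK // => ->.
  - by rewrite [j <= k]leqNgt (ltnW jk).
  rewrite jk /= ltnn eqxx column_nil //.
  by apply/allP=> a /rT /=; rewrite rk ltnS.
have kT' := ends_behead rk kT.
by rewrite !column_cons IH //; case: eqP => // _; rewrite rcons_cat.
Qed.

Lemma restr_cons r T i : restr (r :: T) i =
  (if [seq e <- r | e <= i] == [::] then [::] else [:: [seq e <- r | e <= i]])
  ++ restr T i.
Proof. by rewrite /restr /=; case: eqP. Qed.

Lemma restr_grow i k e T : i < e -> restr (grow k e T) i = restr T i.
Proof.
move=> ie; elim: T => [|r T IH] /=; first by rewrite restr_cons /= leqNgt ie.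
case: eqP => _; rewrite !restr_cons ?IH //.
by rewrite filter_rcons leqNgt ie.
Qed.

Lemma restr_id i T : 0 \notin shape T -> all (fun e => e <= i) (flatten T) ->
  restr T i = T.
Proof.
elim: T => //= r T IH; rewrite inE negb_or all_cat => /andP[r0 T0] /andP[ri Ti].
rewrite restr_cons (all_filterP ri) IH //.
by case: (r) r0.
Qed.

Lemma row_with_cons r T i :
  row_with (r :: T) i = if i \in r then r else row_with T i.
Proof. by rewrite /row_with /=; case: ifP. Qed.

Lemma col_of_grow i k e T : i != e -> col_of (grow k e T) i = col_of T i.
Proof.
move=> ie; rewrite /col_of; congr _.+1; elim: T => [|r T IH] /=.
  by rewrite row_with_cons inE (negPf ie).
case: eqP => _; rewrite !row_with_cons; last by case: ifP.
rewrite mem_rcons inE (negPf ie) /=; case: ifP => // ir.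
by rewrite -cats1 index_cat ir.
Qed.

Lemma col_of_grow_new k e T : e \notin flatten T -> k \in 0 :: shape T ->
  col_of (grow k e T) e = k.+1.
Proof.
rewrite /col_of => eT kT; congr _.+1; elim: T eT kT => [|r T IH] /=.
  by rewrite inE => _ /eqP->; rewrite row_with_cons inE eqxx /= eqxx.
rewrite mem_cat negb_or => /andP[er eT] kT; case: eqP => [rk|/eqP rk].
  by rewrite row_with_cons mem_rcons mem_head -cats1 index_cat (negPf er) /= eqxx addn0.
by rewrite row_with_cons (negPf er) IH // (ends_behead rk).
Qed.

Lemma mem_column j x T : 0 < j -> x \in column j T -> x \in flatten T.
Proof.
move=> j0 /mapP[r]; rewrite mem_filter => /andP[jr rT] ->.
by apply/flattenP; exists r; rewrite // mem_nth // prednK.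
Qed.

Lemma column_cat j T1 T2 : column j (T1 ++ T2) = column j T1 ++ column j T2.
Proof. by rewrite /column filter_cat map_cat. Qed.

Lemma notin0_shape_grow k e T : 0 \notin shape T -> 0 \notin shape (grow k e T).
Proof.
elim: T => //= r T IH; rewrite inE negb_or => /andP[r0 T0].
case: eqP => _ /=; rewrite inE negb_or; last by rewrite r0 IH.
by rewrite size_rcons T0.
Qed.

Lemma sorted_ltn_rcons s e : all (fun a => a < e) s ->
  sorted ltn (rcons s e) = sorted ltn s.
Proof. by move=> se; rewrite !(sorted_pairwise ltn_trans) pairwise_rcons se. Qed.

Lemma rows_sorted_grow k e T : all (fun a => a < e) (flatten T) ->
  all (sorted ltn) (grow k e T) = all (sorted ltn) T.
Proof.
elim: T => //= r T IH; rewrite all_cat => /andP[re Te].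
by case: eqP => _ /=; rewrite ?sorted_ltn_rcons // IH.
Qed.

Lemma columns_sorted_grow k e T n :
  sorted geq (shape T) -> k \in 0 :: shape T ->
  all (fun a => a < e) (flatten T) ->
  all (fun j => sorted ltn (column j (grow k e T))) (iota 1 n) =
  all (fun j => sorted ltn (column j T)) (iota 1 n).
Proof.
move=> sT kT Te; apply: eq_in_all => j; rewrite mem_iota => /andP[j0 _].
rewrite column_grow //; case: ifP => // _; rewrite sorted_ltn_rcons //.
by apply/allP=> a /(mem_column j0) /(allP Te).
Qed.

Lemma sumn_ge (s : seq nat) a : a \in s -> a <= sumn s.
Proof.
elim: s => //= b s IH; rewrite inE => /predU1P[->|/IH h]; first exact: leq_addr.
exact: leq_trans h (leq_addl _ _).
Qed.

Lemma iota1_rcons n : iota 1 n.+1 = rcons (iota 1 n) n.+1.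
Proof. by rewrite -cats1 -(addn1 n) iotaD add1n addn1. Qed.

Lemma perm_iota_rcons n s :
  perm_eq (n.+1 :: s) (iota 1 n.+1) = perm_eq s (iota 1 n).
Proof.
by rewrite iota1_rcons perm_sym perm_rcons perm_cons perm_sym.
Qed.

(** The entry [n.+1] exceeds all the others and ends its row and its column, hence
    it never spoils or repairs an increasing row or column. *)
Lemma is_syt_grow n k T :
  sorted geq (shape T) -> 0 \notin shape T -> k \in 0 :: shape T ->
  is_syt n.+1 (grow k n.+1 T) = is_syt n T.
Proof.
move=> sT T0 kT; rewrite /is_syt /is_partition shape_grow // sT.
rewrite notin0_shape_grow // T0 !andTb.
rewrite -!size_flatten (perm_size (flatten_grow _ _ _)) [size (_ :: _)]/= eqSS.
case: eqP => // Tn; rewrite !andTb.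
rewrite (permPl (flatten_grow _ _ _)) perm_iota_rcons.
case: (boolP (perm_eq _ _)) => // pT; rewrite !andTb.
have Te : all (fun a => a < n.+1) (flatten T).
  by apply/allP=> a; rewrite (perm_mem pT) mem_iota; lia.
rewrite rows_sorted_grow // columns_sorted_grow // iota1_rcons all_rcons.
rewrite [column n.+1 T]column_nil //.
by apply/allP=> a /sumn_ge; rewrite -size_flatten Tn ltnS.
Qed.

Lemma grow_cat k e T1 T2 : k \notin shape T1 ->
  grow k e (T1 ++ T2) = T1 ++ grow k e T2.
Proof.
elim: T1 => //= r T1 IH; rewrite inE negb_or eq_sym => /andP[/negPf-> /IH->].
by [].
Qed.

(** Removing the largest entry.  It ends its row, and no row above can be as long:
    such a row would hold a larger entry in the same column. *)
Lemma syt_grow_ex n T' : is_syt n.+1 T' -> exists k T,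
  [/\ is_syt n T, k \in 0 :: shape T & T' = grow k n.+1 T].
Proof.
move=> sytT'; case/and4P: (sytT') => /and3P[sT' T'0 T'n] pT' rT' cT'.
have geqT : transitive geq by move=> a b c /=; lia.
have T'le a : a \in flatten T' -> a <= n.+1.
  by rewrite (perm_mem pT') mem_iota; lia.
have /flattenP[r' r'T' er'] : n.+1 \in flatten T'.
  by rewrite (perm_mem pT') mem_iota; lia.
have [r def_r'] : exists r, r' = rcons r n.+1.
  case/lastP: r' => // r z in r'T' er' *; exists r; congr rcons.
  have := allP rT' _ r'T'; rewrite (sorted_pairwise ltn_trans) pairwise_rcons.
  case/andP=> /allP rz _; move: er'; rewrite mem_rcons inE => /predU1P[->//|/rz /=].
  have := T'le z; rewrite ltnNge => ->//.
  by apply/flattenP; exists (rcons r z) => //; rewrite mem_rcons mem_head.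
subst r'; case/splitPr: r'T' => T1 T2 in sytT' sT' T'0 T'n pT' rT' cT' T'le *.
set k := size r.
have T2k : all (fun a => a <= k) (shape T2).
  apply/allP=> _ /mapP[t tT2 ->]; rewrite leqNgt; apply/negP=> kt.
  have kn : k.+1 \in iota 1 n.+1.
    rewrite mem_iota /=; have := @sumn_ge (shape (T1 ++ rcons r n.+1 :: T2)) k.+1.
    rewrite (eqP T'n) ltnS; apply; rewrite /shape map_cat mem_cat /= inE.
    by rewrite size_rcons eqxx orbT.
  have := allP cT' _ kn; rewrite (sorted_pairwise ltn_trans) column_cat column_cons.
  rewrite size_rcons leqnn nth_rcons /= ltnn eqxx pairwise_cat /=.
  case/and4P=> _ _ /allP /(_ (nth 0 t k)) h _; move: h.
  rewrite ltnNge T'le; last first.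
    by apply/flattenP; exists t; rewrite ?mem_nth // mem_cat inE tT2 !orbT.
  suff m : nth 0 t k \in column k.+1 T2 by move/(_ m).
  by apply/mapP; exists t; rewrite // mem_filter kt.
move: sT' T'0; rewrite /shape map_cat /= -!/(shape _) size_rcons -/k.
rewrite (sorted_pairwise geqT) pairwise_cat allrel_consr /=.
case/and3P=> /andP[T1k T12] pT1 /andP[kT2 pT2].
rewrite mem_cat inE /= negb_or => /andP[T10 T20].
have kT1 : k \notin shape T1.
  by apply/negP=> /(allP T1k) /=; rewrite ltnn.
suff [T [sT T0 kT gT]] : exists T, [/\ sorted geq (shape T), 0 \notin shape T,
    k \in 0 :: shape T & T1 ++ rcons r n.+1 :: T2 = grow k n.+1 T].
  by exists k, T; rewrite -(is_syt_grow n sT T0 kT) -gT.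
have [k0|kn0] := eqVneq k 0.
  exists T1; rewrite (sorted_pairwise geqT) pT1 T10 k0 mem_head; split=> //.
  rewrite -k0 -[in RHS](cats0 T1) grow_cat //.
  have -> : T2 = [::].
    case: (T2) T2k T20 => //= t T3; rewrite k0 leqn0 inE negb_or eq_sym.
    by case/andP=> ->.
  by rewrite (size0nil k0).
exists (T1 ++ r :: T2).
rewrite (sorted_pairwise geqT) /shape !map_cat /= -!/(shape _) -/k.
split.
- rewrite pairwise_cat allrel_consr /= pT1 pT2 T12 T2k !andbT.
  by apply/allP=> a /(allP T1k) /= /ltnW.
- by rewrite mem_cat inE eq_sym (negPf kn0) !negb_or T10 T20.
- by rewrite !inE mem_cat inE eqxx !orbT.
by rewrite grow_cat //= eqxx.
Qed.

Lemma syt_props n T : is_syt n T ->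
  [/\ sorted geq (shape T), 0 \notin shape T, sumn (shape T) = n &
   forall a, (a \in flatten T) = (0 < a <= n)].
Proof.
case/and4P=> /and3P[sT T0 /eqP Tn] pT _ _; split=> // a.
by rewrite (perm_mem pT) mem_iota; lia.
Qed.

Lemma restr_syt n i T : is_syt n T -> n <= i -> restr T i = T.
Proof.
move=> /syt_props[_ T0 _ Tf] ni; apply: restr_id => //.
by apply/allP=> a; rewrite Tf => /andP[_ /leq_trans]; apply.
Qed.

(** Enumerates the standard tableaux along the growth process, so that sums over
    them obey a recursion in the size. *)
Fixpoint syts n : seq tableau :=
  if n is m.+1 then [seq grow k n T | T <- syts m, k <- ends T] else [:: [::]].

Lemma mem_syts n T : (T \in syts n) = is_syt n T.
Proof.
elim: n T => [|n IH] T.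
  rewrite inE; apply/eqP/idP => [->//|/syt_props[_ T0 Tn _]].
  case: T T0 Tn => //= r T; rewrite inE negb_or => /andP[r0 _].
  by move/eqP; rewrite addn_eq0 eq_sym (negPf r0).
apply/allpairsPdep/idP => [[T1 [k [T1n kT ->]]]|/syt_grow_ex[k [T1 [T1n kT ->]]]].
  rewrite mem_ends in kT; rewrite IH in T1n.
  by have [? ? _ _] := syt_props T1n; rewrite is_syt_grow.
by exists T1, k; rewrite IH mem_ends.
Qed.

(** A grown tableau determines both the old one, by deletion of the largest entry,
    and the row length [k], by the column of that entry. *)
Lemma uniq_syts n : uniq (syts n).
Proof.
elim: n => [//|n IH].
apply: (@allpairs_uniq_dep _ (fun=> nat) _ (fun T k => grow k n.+1 T)) => //.
  move=> T; rewrite mem_syts => /syt_props[_ T0 _ _].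
  by rewrite /ends /= mem_undup T0 undup_uniq.
move=> _ _ /allpairsPdep[T [k [Tn kT ->]]] /allpairsPdep[T1 [k1 [T1n kT1 ->]]] /=.
rewrite !mem_syts !mem_ends in Tn kT T1n kT1 => eqg.
have eT : T = T1.
  by rewrite -(restr_syt Tn (leqnn n)) -(restr_syt T1n (leqnn n))
    -(@restr_grow n k n.+1) // eqg restr_grow.
subst T1; have nT : n.+1 \notin flatten T.
  by have [_ _ _ ->] := syt_props Tn; rewrite ltnn.
by have := congr1 (col_of ^~ n.+1) eqg; rewrite /= !col_of_grow_new // => -[->].
Qed.

Lemma sum_SYT (R : nmodType) n (F : tableau -> R) :
  (\sum_(T : SYT n) F T = \sum_(T <- syts n) F T)%R.
Proof.
rewrite -[LHS](big_map (@rows_of n) xpredT F); apply: perm_big.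
have inj : injective (@rows_of n) by exact: val_inj.
apply: uniq_perm; rewrite ?uniq_syts ?map_inj_uniq ?index_enum_uniq //.
move=> T; rewrite mem_syts; apply/mapP/idP => [[S _ ->]|Tn]; first exact: rows_ofP.
by exists (MkSYT Tn); rewrite ?mem_index_enum.
Qed.

(** * Insertion weights *)

(** The multiplicity with which a derivation turns the monomial of [T] into the
    monomial of [grow k n.+1 T]: for [k = 0] it is the exponent of [g 0] in
    [tower_term], otherwise the number of factors [g k]. *)
Definition growth_weight (m n k : nat) (T : tableau) : nat :=
  if k == 0 then m * n + 1 - size T else count_mem k (shape T).

Lemma size_le_sumn s : 0 \notin s -> size s <= sumn s.
Proof.
elim: s => //= a s IH; rewrite inE negb_or => /andP[a0 /IH]; lia.
Qed.

Lemma size_syt n T : is_syt n T -> size T <= n.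
Proof.
move=> /syt_props[_ T0 <- _]; rewrite -(size_map size T); exact: size_le_sumn.
Qed.

Lemma col1 T : 0 \notin shape T -> col 1 T = size T.
Proof.
move=> T0; rewrite /col /column size_map; congr size; apply/all_filterP/allP.
by move=> r rT; rewrite lt0n; apply: contraNneq T0 => <-; apply: map_f.
Qed.

(** This is why the difference of adjacent column heights in the definition of the
    box sorting indices counts rows of a given length. *)
Lemma colB k T : col k T = col k.+1 T + count_mem k (shape T).
Proof.
rewrite /col /column !size_map; elim: T => //= r T IH.
by case: (ltngtP k (size r)) => _ /=; rewrite ?IH //; lia.
Qed.

Lemma sigma_grow n k T : is_syt n T -> k \in 0 :: shape T ->
  sigma (grow k n.+1 T) n.+1 = growth_weight 1 n k T.
Proof.
move=> Tn kT; have [sT T0 _ Tf] := syt_props Tn.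
have Tn' : is_syt n.+1 (grow k n.+1 T) by rewrite is_syt_grow.
rewrite /sigma /growth_weight col_of_grow_new ?Tf ?ltnn //.
rewrite (restr_syt Tn') // eqSS mul1n /=.
have nT := size_syt Tn.
have cE j : 0 < j -> col j (grow k n.+1 T) = col j T + (j == k.+1).
  by move=> j0; rewrite /col column_grow //; case: eqP; rewrite ?size_rcons; lia.
case: eqP => k0; first by rewrite cE // col1 // k0; lia.
have kT' : k \in shape T by move: kT; rewrite inE; case: eqP k0.
have : 0 < count_mem k (shape T) by rewrite -has_count has_pred1.
rewrite !cE ?lt0n //; last exact/eqP.
rewrite (colB k T) eqxx (ltn_eqF (ltnSn k)) addn0.
by move: (col _ _) (count_mem _ _) => c1 c2; lia.
Qed.

Lemma delta_grow n k T : is_syt n T -> k \in 0 :: shape T ->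
  delta (grow k n.+1 T) n.+1 = growth_weight 2 n k T.
Proof.
move=> Tn kT; have := sigma_grow Tn kT; have [sT T0 _ Tf] := syt_props Tn.
rewrite /sigma /delta /growth_weight col_of_grow_new ?Tf ?ltnn // eqSS.
case: eqP => // k0 _.
have Tn' : is_syt n.+1 (grow k n.+1 T) by rewrite is_syt_grow.
rewrite (restr_syt Tn') // /col column_grow // k0 size_rcons -/(col 1 T) col1 //.
lia.
Qed.

Lemma sigma_grow_lt i k e T : i < e -> sigma (grow k e T) i = sigma T i.
Proof. by move=> ie; rewrite /sigma restr_grow // col_of_grow // ltn_eqF. Qed.

Lemma delta_grow_lt i k e T : i < e -> delta (grow k e T) i = delta T i.
Proof. by move=> ie; rewrite /delta restr_grow // col_of_grow // ltn_eqF. Qed.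

Lemma perm_shape_grow k e T : k \in shape T ->
  perm_eq (shape (grow k e T)) (k.+1 :: rem k (shape T)).
Proof.
elim: T => //= r T IH; rewrite inE eq_sym.
case: eqP => [rk _|rk /= kT] /=; first by rewrite size_rcons rk.
apply: (@perm_trans _ (size r :: k.+1 :: rem k (shape T))).
  by rewrite perm_cons IH.
exact: (permEl (perm_catCA [:: size r] [:: k.+1] _)).
Qed.

Lemma shape_grow0 e T : 0 \notin shape T -> shape (grow 0 e T) = rcons (shape T) 1.
Proof.
by elim: T => //= r T IH; rewrite inE negb_or eq_sym => /andP[/negPf-> /IH <-].
Qed.

(** * Expansion of an iterated derivation over standard tableaux *)

Local Open Scope ring_scope.

Section Tower.
Variables (R : comNzRingType) (D : {additive R -> R}).
Hypothesis DM : forall a b, D (a * b) = D a * b + a * D b.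

Lemma deriv1 : D 1 = 0.
Proof. by apply: (addIr (D 1)); rewrite add0r -[in RHS](mul1r 1) DM mul1r mulr1. Qed.

Lemma derivX a n : D (a ^+ n) = (D a * a ^+ n.-1) *+ n.
Proof.
elim: n => [|n IH]; first by rewrite expr0 deriv1 mulr0n.
rewrite exprS DM IH mulrnAr mulrCA -exprS [RHS]mulrS.
by case: n {IH} => // n; rewrite !mulr0n.
Qed.

Lemma deriv_prod (g : nat -> R) s :
  D (\prod_(k <- s) g k) = \sum_(k <- s) D (g k) * \prod_(j <- rem k s) g j.
Proof.
elim: s => [|a s IH]; first by rewrite !big_nil deriv1.
rewrite !big_cons DM IH /= eqxx mulr_sumr; congr (_ + _).
apply: eq_big_seq => k ks; case: eqP => [->|_]; rewrite ?big_cons mulrCA //.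
by rewrite [in RHS](big_rem _ ks).
Qed.

Variables (m : nat) (g : nat -> R).
Hypotheses (m_gt0 : (0 < m)%N) (Dg : forall i, D (g i) = g 0%N ^+ m * g i.+1).

Definition tower_term n (T : tableau) : R :=
  g 0%N ^+ (m * n + 1 - size T) * \prod_(k <- shape T) g k.

(** Leibniz' rule gives one summand per factor; equal factors [g k] give equal
    summands, and collecting them yields the multiplicity in the weight. *)
Lemma deriv_term n T : is_syt n T ->
  D (tower_term n T) =
  \sum_(k <- ends T) tower_term n.+1 (grow k n.+1 T) *+ growth_weight m n k T.
Proof.
move=> Tn; have [sT T0 _ _] := syt_props Tn.
have nT : (size T <= m * n)%N.
  by apply: leq_trans (size_syt Tn) _; rewrite leq_pmull.
have szS T' : size (shape T') = size T' by rewrite size_map.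
rewrite /tower_term /ends big_cons DM derivX Dg; congr (_ + _).
  rewrite shape_grow0 // big_rcons -!(szS (grow _ _ _)) shape_grow0 // size_rcons.
  rewrite szS /growth_weight eqxx mulrnAl; congr (_ *+ _).
  rewrite (_ : (m * n.+1 + 1 - (size T).+1 = m + (m * n + 1 - size T).-1)%N); last lia.
  by rewrite exprD /=; ring.
rewrite deriv_prod mulr_sumr -big_undup_iterop_count; apply: eq_big_seq => k.
rewrite mem_undup => kT; rewrite -[iterop _ _ _ _]/(_ *+ _).
have k0 : (k == 0%N) = false by apply: contraNF T0 => /eqP<-.
rewrite /growth_weight k0; congr (_ *+ _).
rewrite Dg (perm_big _ (perm_shape_grow n.+1 kT)) /= big_cons.
rewrite -(szS (grow _ _ _)) (perm_size (perm_shape_grow n.+1 kT)) /= size_rem //.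
rewrite szS prednK; last by case: (T) kT.
rewrite (_ : (m * n.+1 + 1 - size T = m + (m * n + 1 - size T))%N); last by nia.
by rewrite exprD; ring.
Qed.

Variable wt : tableau -> nat -> nat.
Hypothesis wt_old : forall i k e T, (i < e)%N -> wt (grow k e T) i = wt T i.
Hypothesis wt_new : forall n k T, is_syt n T -> k \in 0%N :: shape T ->
  wt (grow k n.+1 T) n.+1 = growth_weight m n k T.

(** The weight of a tableau is only required to be multiplicative along growth,
    which covers both box sorting indices. *)
Lemma iter_tower n : iter n D (g 0%N) =
  \sum_(T <- syts n) tower_term n T *+ \prod_(1 <= i < n.+1) wt T i.
Proof.
elim: n => [|n IH].
  rewrite big_seq1 big_geq // /tower_term muln0 /= big_nil mulr1 expr1; done.
rewrite iterS IH raddf_sum -/([seq grow k n.+1 T | T <- syts n, k <- ends T]).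
rewrite big_allpairs_dep; apply: eq_big_seq => T.
rewrite mem_syts => Tn; rewrite raddfMn deriv_term // -sumrMnl.
apply: eq_big_seq => k; rewrite mem_ends => kT.
rewrite -mulrnA [in RHS]big_nat_recr //= wt_new // mulnC; congr (_ *+ (_ * _)).
by apply: eq_big_nat => i /andP[_ ilt]; rewrite wt_old.
Qed.

End Tower.

(** * A three-term recurrence for iterated derivatives *)

Section ThreeTerm.
Variables (R : comNzRingType) (D : {additive R -> R}).
Hypothesis DM : forall a b, D (a * b) = D a * b + a * D b.

Lemma deriv_nat n : D n%:R = 0.
Proof. by rewrite raddfMn (deriv1 DM) mul0rn. Qed.

Variables (G h c v : R) (e : nat).
Hypotheses (Dc : D c = 0) (DG : D G = h * G ^+ 2) (Dh : D h = c * G ^+ 3).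

Let step n a b :=
  (2 * n + 1)%:R * (h * G * a) - (n ^ 2)%:R * ((h ^+ 2 - c * G ^+ 2) * G ^+ 2 * b)
  + e%:R * ((h ^+ 2 - c * G ^+ 2) * G ^+ 2 * b).

(** The constant [K = h ^+ 2 - c * G ^+ 2] has derivative 0 and
    [D (h * G) = G ^+ 2 * (h ^+ 2 + c * G ^+ 2)], so that differentiating the relation
    at rank [n] and eliminating the lowest term by that same relation gives it at
    rank [n.+1].  The number [e] is preserved; it is 0 for [v = G], and 1 for [v]
    with [D v = 2 * G ^+ 3]. *)
Lemma three_term n :
  D (D v) = step 1 (D v) v ->
  iter n.+2 D v = step n.+1 (iter n.+1 D v) (iter n D v).
Proof.
move=> base; elim: n => [//|n IH]; rewrite iterS IH.
rewrite /step in IH *.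
rewrite !(raddfD, raddfN, DM, deriv_nat, derivX DM, Dc, DG, Dh) -!iterS IH.
move: (iter n D v) (iter n.+1 D v) => a b /=.
ring.
Qed.
End ThreeTerm.

(** * The vector field and its two towers *)

Section Flow.
Variables (F : fieldType) (x : F).
Notation R := {mpoly F[2]}.

Let eta : R := 'X_ord0.
Let del : R := 'X_ord_max.

Definition flow (p : R) : R :=
  p^`M(ord0) * (eta ^+ 2 * del ^+ 3) + p^`M(ord_max) * (x%:MP * eta ^+ 3 * del ^+ 2).

Lemma flow_is_additive : zmod_morphism flow.
Proof. by move=> p q; rewrite /flow !raddfB /=; ring. Qed.

HB.instance Definition _ := GRing.isZmodMorphism.Build R R flow flow_is_additive.

Lemma flowM p q : flow (p * q) = flow p * q + p * flow q.
Proof. by rewrite /flow !mderivM; ring. Qed.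

Lemma flowD p q : flow (p + q) = flow p + flow q.
Proof. exact: raddfD. Qed.

Lemma flow_sub p q : flow (p - q) = flow p - flow q.
Proof. exact: raddfB. Qed.

Lemma flowX p n : flow (p ^+ n) = (flow p * p ^+ n.-1) *+ n.
Proof. exact: derivX flowM _ _. Qed.

Lemma mderivXU n (K : nzRingType) (i j : 'I_n) :
  ('X_i : {mpoly K[n]})^`M(j) = (i == j)%:R.
Proof.
rewrite mderivX mnm1E; case: eqP => [->|_]; last by rewrite scale0r.
rewrite scale1r (_ : (U_(j) - U_(j))%MM = 0%MM) ?mpolyX0 //.
by apply/mnmP=> k; rewrite mnmBE subnn mnm0E.
Qed.

Lemma flow_eta : flow eta = eta ^+ 2 * del ^+ 3.
Proof. by rewrite /flow !mderivXU /= mul1r mul0r addr0. Qed.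

Lemma flow_del : flow del = x%:MP * eta ^+ 3 * del ^+ 2.
Proof. by rewrite /flow !mderivXU /= mul1r mul0r add0r. Qed.

Lemma flowC a : flow a%:MP = 0.
Proof. by rewrite /flow !mderivC !mul0r addr0. Qed.

Let G := eta * del.
Let h := del ^+ 2 + x%:MP * eta ^+ 2.
Let c : R := (4 * x)%:MP.

Let cE : c = 4 * x%:MP.
Proof. by rewrite /c mpolyCM rmorph_nat. Qed.

Let flowG : flow G = h * G ^+ 2.
Proof. by rewrite flowM flow_eta flow_del /h /G; ring. Qed.

Let flowh : flow h = c * G ^+ 3.
Proof.
rewrite flowD flowM flowC !flowX /= flow_eta flow_del cE /G; ring.
Qed.

Definition at1 (p : R) : F := p.@[fun=> 1].

Let at1E : (at1 eta = 1) * (at1 del = 1).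
Proof. by rewrite /at1 !mevalXU. Qed.

Let at1M p q : at1 (p * q) = at1 p * at1 q.
Proof. exact: mevalM. Qed.

Let at1K : at1 ((h ^+ 2 - c * G ^+ 2) * G ^+ 2) = (1 - x) ^+ 2.
Proof.
rewrite /at1 !(rmorphM, rmorphB, rmorphD, rmorphXn) /= !mevalC -!/(at1 _) !at1E.
ring.
Qed.

Let at1hG : at1 (h * G) = 1 + x.
Proof.
rewrite /at1 !(rmorphM, rmorphB, rmorphD, rmorphXn) /= !mevalC -!/(at1 _) !at1E.
ring.
Qed.

Lemma at1_three_term (v : R) (e n : nat) :
  flow (flow v) = 3 * (h * G * flow v)
    - (1 - e%:R) * ((h ^+ 2 - c * G ^+ 2) * G ^+ 2 * v) ->
  at1 (iter n.+2 flow v) =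
    (2 * n.+1 + 1)%:R * (1 + x) * at1 (iter n.+1 flow v)
    - ((n.+1 ^ 2)%:R - e%:R) * (1 - x) ^+ 2 * at1 (iter n flow v).
Proof.
move=> base; rewrite (three_term flowM (flowC _) flowG flowh (e := e)).
  by rewrite [LHS]/at1 !(rmorphD, rmorphB, mevalM, rmorph_nat)
    -!/(at1 _) -at1K -at1hG; ring.
by rewrite -[LHS]/(flow (flow v)) base; ring.
Qed.

(** Iterated derivatives in the variable z with dz = G^2 du: there the
    derivative of [G] is [h] and that of [h] is [4 x G], so the second
    derivative multiplies by [4 x]. *)
Definition towerB (i : nat) : R :=
  (4 * x)%:MP ^+ i./2 * (if odd i then h else G).

Lemma flow_towerB i : flow (towerB i) = towerB 0 ^+ 2 * towerB i.+1.
Proof.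
rewrite /towerB /= flowM flowX flowC mul0r mul0rn mul0r add0r uphalf_half.
by case: (odd i); rewrite /= ?flowG ?flowh /= -/c ?add1n ?exprS; ring.
Qed.

Lemma at1_towerB i : at1 (towerB i) = (4 * x) ^+ i./2 * (if odd i then x + 1 else 1).
Proof.
rewrite /towerB at1M {1}/at1 rmorphXn /= mevalC; case: ifP => _; congr (_ * _).
  rewrite /at1 !(rmorphM, rmorphB, rmorphD, rmorphXn) /= !mevalC -!/(at1 _) !at1E; ring.
by rewrite at1M !at1E mulr1.
Qed.

Lemma flowB_three_term n :
  at1 (iter n.+2 flow (towerB 0)) =
    (2 * n.+1 + 1)%:R * (1 + x) * at1 (iter n.+1 flow (towerB 0))
    - (n.+1 ^ 2)%:R * (1 - x) ^+ 2 * at1 (iter n flow (towerB 0)).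
Proof.
rewrite (at1_three_term _ (e := 0)) ?subr0 //.
rewrite /towerB expr0 mul1r /= flowG flowM flowX flowG flowh /=.
ring.
Qed.

Section TypeA.
Variables (y : F) (charF : [pchar F] =i pred0).
Hypotheses (y_neq0 : y != 0) (y_sqrt : y ^+ 2 = x).

Let A : R := (y%:MP * eta + del) * del.
Let B : R := (y%:MP * eta - del) * del.

Let xE : x%:MP = y%:MP ^+ 2 :> R.
Proof. by rewrite -y_sqrt rmorphXn. Qed.

Let flowA : flow A = y%:MP * eta ^+ 2 * A ^+ 2.
Proof.
rewrite /A !flowM flowD flowM flowC flow_eta flow_del xE /=; ring.
Qed.

Let flowB : flow B = y%:MP * eta ^+ 2 * B ^+ 2.
Proof.
rewrite /B !flowM flow_sub flowM flowC flow_eta flow_del xE /=; ring.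
Qed.

(** The terms of positive index are iterated derivatives, in the variable z with
    dz = y eta^2 du, of the partial fraction sum (A - B) / 2 up to scaling.
    There A and B are of the form a / (1 - a z), whose i-th derivative is
    i! A^(i+1).  The term of index 0 is eta^2 rather than
    y^(-2) (A - B) / 2 = y^(-2) del^2; as x eta^2 - del^2 is constant along the flow,
    both have the same derivative. *)
Definition towerA (i : nat) : R :=
  if i is 0 then eta ^+ 2
  else (y ^- 2 * y ^+ i * i`!%:R / 2)%:MP * (A ^+ i.+1 - B ^+ i.+1).

(** The passage from index 0 to index 1 rests on A^2 - B^2 = 4 y eta del^3;
    the later ones on the equation D f = y eta^2 f^2 of A and B. *)
Lemma flow_towerA i : flow (towerA i) = towerA 0 ^+ 1 * towerA i.+1.
Proof.
have two : 2%:R != 0 :> F by rewrite (proj1 (pcharf0P F) charF).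
case: i => [|i].
  rewrite /towerA flowX flow_eta expr1.
  have -> : A ^+ 2 - B ^+ 2 = (4 * y)%:MP * eta * del ^+ 3.
    by rewrite mpolyCM rmorph_nat /A /B; ring.
  set C := mpolyC _ _; have CE : C * (4 * y)%:MP = 2%:R.
    rewrite -mpolyCM -[RHS]mpolyC_nat; congr mpolyC.
    by rewrite factS fact0 muln1; field; rewrite two.
  by transitivity (C * (4 * y)%:MP * (eta ^+ 3 * del ^+ 3)); [rewrite CE|]; ring.
rewrite /towerA flowM flowC mul0r add0r flow_sub /= !flowX flowA flowB.
rewrite (_ : y ^- 2 * y ^+ i.+2 * i.+2`!%:R / 2 =
   y ^- 2 * y ^+ i.+1 * i.+1`!%:R / 2 * (i.+2%:R * y)); last first.
  by rewrite factS natrM (exprS y i.+1); field; rewrite two.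
move: (y ^- 2 * y ^+ i.+1 * _ / 2) => K.
rewrite !mpolyCM mpolyC_nat !exprS; ring.
Qed.

Lemma at1_towerA0 : at1 (towerA 0) = 1.
Proof. by rewrite /= /at1 rmorphXn /= -/(at1 _) at1E expr1n. Qed.

Lemma at1_towerAS i : at1 (towerA i.+1) =
  y ^- 2 * y ^+ i.+1 * i.+1`!%:R / 2 * ((y + 1) ^+ i.+2 - (y - 1) ^+ i.+2).
Proof.
rewrite at1M {1}/at1 mevalC; congr (_ * _).
rewrite /at1 rmorphB !rmorphXn /= /A /B !(rmorphM, rmorphB, rmorphD) /= !mevalC.
by rewrite -!/(at1 _) !at1E !mulr1.
Qed.

Let flow_g : flow (towerA 0) = 2 * G ^+ 3.
Proof. by rewrite /= flowX flow_eta /G; ring. Qed.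

Lemma flowA_three_term n :
  at1 (iter n.+2 flow (towerA 0)) =
    (2 * n.+1 + 1)%:R * (1 + x) * at1 (iter n.+1 flow (towerA 0))
    - ((n.+1 ^ 2)%:R - 1) * (1 - x) ^+ 2 * at1 (iter n flow (towerA 0)).
Proof.
rewrite (at1_three_term _ (e := 1)) // flow_g flowM -(mpolyC_nat 2) flowC.
rewrite flowX flowG /=; ring.
Qed.

Lemma flowA_first : at1 (iter 1 flow (towerA 0)) = 2.
Proof.
rewrite [iter _ _ _]/= flow_g /at1 !(rmorphM, rmorphXn) /= -!/(at1 _) !at1E.
rewrite -mpolyC_nat /at1 mevalC; ring.
Qed.

End TypeA.

Lemma flowB_first : (at1 (towerB 0) = 1) * (at1 (flow (towerB 0)) = 1 + x).
Proof.
split; first by rewrite at1_towerB mulr1.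
rewrite /towerB expr0 mul1r /= flowG.
have -> : h * G ^+ 2 = h * G * G by ring.
by rewrite at1M at1hG at1M !at1E !mulr1.
Qed.

End Flow.

(** * Recurrences of the Narayana polynomials *)

Section Narayana.
Variable F : fieldType.

Lemma bin_ratio n k :
  k.+1%:R * 'C(n, k.+1)%:R = (n%:R - k%:R) * 'C(n, k)%:R :> F.
Proof.
have [kn|nk] := leqP k n; first by rewrite -natrB // -!natrM mul_bin_left.
by rewrite !bin_small ?mulr0 //; apply: leqW.
Qed.

Lemma coef_narayanaB n k : (narayanaB F n)`_k = 'C(n, k)%:R ^+ 2.
Proof.
rewrite /narayanaB -(poly_def n.+1 (fun k => 'C(n, k)%:R ^+ 2)) coef_poly ltnS.
by case: leqP => // nk; rewrite bin_small // expr0n.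
Qed.

(** Coefficientwise this is quadratic in three consecutive binomials p, q, r of
    [n], which satisfy two linear relations; the proof displays the difference of
    the two sides as a combination of those relations, valid without dividing. *)
Lemma narayanaB_rec n :
  n.+2%:R *: narayanaB F n.+2 =
    (2 * n.+1 + 1)%:R *: (narayanaB F n.+1 + 'X * narayanaB F n.+1) -
    n.+1%:R *: (narayanaB F n - ('X * narayanaB F n) *+ 2
                + 'X * ('X * narayanaB F n)).
Proof.
apply/polyP => k.
rewrite !(coefD, coefB, coefN, coefZ, coefMn, coefXM, coef_narayanaB).
case: k => [|[|k]] /=.
- by rewrite !bin0; ring.
- by rewrite ?coef_narayanaB !bin0 !bin1; ring.
rewrite ?coef_narayanaB !binS.
have e1 := bin_ratio n k.+1; have e2 := bin_ratio n k.
move: ('C(n, k.+2)) ('C(n, k.+1)) ('C(n, k)) e1 e2 => p q r e1 e2.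
apply/eqP; rewrite -subr_eq0; apply/eqP.
transitivity (2%:R * ((q%:R + r%:R) * (k.+2%:R * p%:R - (n%:R - k.+1%:R) * q%:R)
  - (p%:R + q%:R) * (k.+1%:R * q%:R - (n%:R - k%:R) * r%:R)) : F); first by ring.
by rewrite e1 e2; ring.
Qed.

(** [n] times [narayanaA F n], free of denominators. *)
Definition narayanaA_num n : {poly F} :=
  \poly_(k < n) ('C(n, k.+1)%:R * 'C(n, k)%:R).

Lemma coef_narayanaA_num n k :
  (narayanaA_num n)`_k = 'C(n, k.+1)%:R * 'C(n, k)%:R.
Proof.
by rewrite coef_poly; case: ltnP => // nk; rewrite bin_small ?mul0r.
Qed.

Lemma narayanaAE n : narayanaA F n = n%:R^-1 *: narayanaA_num n.
Proof.
rewrite /narayanaA /narayanaA_num poly_def scaler_sumr.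
by apply: eq_bigr => k _; rewrite scalerA mulrA.
Qed.

(** As for type B, with four consecutive binomials and three linear relations. *)
Lemma narayanaA_rec n :
  (n.+1 * n.+3)%:R *: narayanaA_num n.+2 =
    ((2 * n.+1 + 1) * n.+2)%:R *: (narayanaA_num n.+1 + 'X * narayanaA_num n.+1) -
    (n.+1 * n.+2)%:R *: (narayanaA_num n - ('X * narayanaA_num n) *+ 2
                + 'X * ('X * narayanaA_num n)).
Proof.
apply/polyP => k.
rewrite !(coefD, coefB, coefN, coefZ, coefMn, coefXM, coef_narayanaA_num).
case: k => [|[|k]] /=.
- by rewrite !bin0 !bin1; ring.
- by rewrite ?coef_narayanaA_num !binS !bin0 !bin1; ring.
rewrite ?coef_narayanaA_num !binS.
have e1 := bin_ratio n k.+2; have e2 := bin_ratio n k.+1; have e3 := bin_ratio n k.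
move: ('C(n, k.+3)) ('C(n, k.+2)) ('C(n, k.+1)) ('C(n, k)) e1 e2 e3 => p q r s e1 e2 e3.
apply/eqP; rewrite -subr_eq0; apply/eqP.
transitivity ((n.+1%:R * s%:R - q%:R + n%:R * r%:R)
    * (k.+3%:R * p%:R - (n%:R - k.+2%:R) * q%:R)
  + (p%:R + q%:R - r%:R - s%:R) * (k.+2%:R * q%:R - (n%:R - k.+1%:R) * r%:R)
  + (r%:R - n.+1%:R * p%:R - n%:R * q%:R) * (k.+1%:R * r%:R - (n%:R - k%:R) * s%:R) : F);
  first by ring.
by rewrite e1 e2 e3; ring.
Qed.

End Narayana.

(** * Identification of the towers with the Narayana polynomials *)

Lemma natS_neq0 (F : fieldType) (charF : [pchar F] =i pred0) n :
  n.+1%:R != 0 :> F.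
Proof. by rewrite (proj1 (pcharf0P F) charF). Qed.

Lemma narayanaB_flow (F : fieldType) (x : F) n :
  n`!%:R * (narayanaB F n).[x] = at1 (iter n (flow x) (towerB x 0)).
Proof.
have [b0 b1] := flowB_first x.
suff H : n`!%:R * (narayanaB F n).[x] = at1 (iter n (flow x) (towerB x 0)) /\
  n.+1`!%:R * (narayanaB F n.+1).[x] = at1 (iter n.+1 (flow x) (towerB x 0)) by case: H.
elim: n => [|n [IH0 IH1]].
  rewrite /= b0 b1 /narayanaB !big_ord_recr !big_ord0 /= !hornerE /=.
  by split; rewrite ?bin0 ?binn ?factS ?fact0; ring.
split=> //; rewrite flowB_three_term -IH0 -IH1.
have := congr1 (horner^~ x) (narayanaB_rec F n); rewrite !hornerE.
move: (_.[x]) (_.[x]) (_.[x]) => v0 v1 v2 rec.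
rewrite factS natrM -mulrA mulrCA rec !factS !natrM; rewrite /=; ring.
Qed.

(** At [n = 0] the identity fails, the left-hand side being 0 and the right-hand
    side 1; this is harmless as the coefficient (n+1)^2 - 1 of the lowest term of
    the recurrence vanishes there. *)
Lemma narayanaA_flow (F : fieldType) (charF : [pchar F] =i pred0) (x y : F) n :
  y ^+ 2 = x -> (0 < n)%N ->
  n.+1`!%:R * (narayanaA F n).[x] = at1 (iter n (flow x) (towerA y 0)).
Proof.
have natF_neq0 := natS_neq0 charF; move=> y_sqrt; case: n => // n _.
have V_rec m : m.+3`!%:R * (narayanaA F m.+2).[x] =
    (2 * m.+1 + 1)%:R * (1 + x) * (m.+2`!%:R * (narayanaA F m.+1).[x])
    - ((m.+1 ^ 2)%:R - 1) * (1 - x) ^+ 2 * (m.+1`!%:R * (narayanaA F m).[x]).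
  (* The denominator m cancels against (m + 1)^2 - 1 = m (m + 2);
     at m = 0 both sides vanish. *)
  have c0 : ((m.+1 ^ 2)%:R - 1) * (narayanaA F m).[x]
      = m.+2%:R * (narayanaA_num F m).[x].
    rewrite narayanaAE hornerZ; case: m => [|m].
      by rewrite /narayanaA_num poly_def big_ord0 horner0; ring.
    by field; rewrite ?nat1r -?natrD natF_neq0.
  rewrite [X in _ - X](_ : _ = (1 - x) ^+ 2 * m.+1`!%:R *
    (((m.+1 ^ 2)%:R - 1) * (narayanaA F m).[x])); last by ring.
  rewrite c0 !narayanaAE !hornerZ.
  have := congr1 (horner^~ x) (narayanaA_rec F m); rewrite /= !hornerE /=.
  move: (_.[x]) (_.[x]) (_.[x]) => a0 a1 a2 rec.
  apply: (mulfI (natF_neq0 m)).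
  transitivity (m.+1`!%:R * ((m.+1 * m.+3)%:R * a2)).
    by rewrite !factS !natrM; field; rewrite ?nat1r -?natrD natF_neq0.
  by rewrite rec !factS !natrM; field; rewrite ?nat1r -?natrD natF_neq0.
have v_rec := flowA_three_term x y.
have v1 : 2`!%:R * (narayanaA F 1).[x] = at1 (iter 1 (flow x) (towerA y 0)).
  rewrite flowA_first narayanaAE hornerZ /narayanaA_num poly_def.
  by rewrite big_ord_recr big_ord0 /= !hornerE /= bin0 binn divr1 !mulr1.
suff H : n.+2`!%:R * (narayanaA F n.+1).[x] = at1 (iter n.+1 (flow x) (towerA y 0)) /\
  n.+3`!%:R * (narayanaA F n.+2).[x] = at1 (iter n.+2 (flow x) (towerA y 0))
  by case: H.
elim: n => [|n [IH0 IH1]]; split=> //.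
  by rewrite V_rec v_rec v1; ring.
by rewrite V_rec v_rec -IH0 -IH1.
Qed.

Lemma sum_even_odd (V : nmodType) (f : nat -> V) m :
  \sum_(0 <= k < m.*2) f k = \sum_(0 <= l < m) (f l.*2 + f l.*2.+1).
Proof.
elim: m => [|m IH]; first by rewrite !big_geq.
by rewrite doubleS !big_nat_recr //= IH addrA.
Qed.

(** The difference of the two binomial expansions keeps the powers of y whose
    exponent has the parity of [i], twice each. *)
Lemma factorAE (F : fieldType) (charF : [pchar F] =i pred0) (y : F) i :
  factorA y i = i`!%:R / 2 * ((y + 1) ^+ i.+1 - (y - 1) ^+ i.+1).
Proof.
have natF_neq0 := natS_neq0 charF; rewrite /factorA -mulrA; congr (_ * _).
apply: (mulfI (natF_neq0 1)); rewrite mulVKf ?natF_neq0 //.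
rewrite !exprDn -sumrB.
(* The summands of odd index k = 2 l + 1 survive, and match those with j = i - l. *)
set f := fun k : nat => (y ^+ (i.+1 - k) * (1 - (-1) ^+ k)) *+ 'C(i.+1, k).
transitivity (\sum_(0 <= k < i.+2) f k); last first.
  by rewrite big_mkord; apply: eq_bigr => k _; rewrite /f expr1n -mulrnBl -mulrBr.
have -> : \sum_(0 <= k < i.+2) f k = \sum_(0 <= k < i.+1.*2) f k.
  rewrite [RHS](@big_cat_nat _ _ _ i.+2) //=; last by lia.
  rewrite [X in _ + X]big_nat [X in _ + X]big1 ?addr0 // => k /andP[ik _].
  by rewrite /f bin_small.
rewrite sum_even_odd mulr_sumr big_mkord [LHS](reindex_inj rev_ord_inj).
apply: eq_bigr => l _; rewrite /f -(signr_odd _ l.*2) -(signr_odd _ l.*2.+1) /=.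
have l_le_i := ltn_ord l; rewrite odd_double /= expr0 expr1.
rewrite subrr mulr0 mul0rn add0r subSS.
have [li|il] := leqP l.*2 i; last first.
  rewrite bin_small ?mulr0n; last by rewrite ltnS.
  rewrite (_ : ((2 * _)%N%:Z - i%:Z)%R = Negz (l.*2 - i).-1); last by lia.
  by rewrite mul0r mulr0.
rewrite (_ : ((2 * _)%N%:Z - i%:Z)%R = Posz (i - l.*2)); last by lia.
rewrite /= subSS -[in RHS]bin_sub; last by lia.
by rewrite subSS -mulr_natr -exprnP; ring.
Qed.

Lemma prod_row_lengths (R : comNzSemiRingType) (f : nat -> R) n T : is_syt n T ->
  \prod_(1 <= i < n.+1) f i ^+ w i T = \prod_(k <- shape T) f k.
Proof.
case/syt_props=> _ T0 Tn _; rewrite /w.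
have : all (fun k => k \in index_iota 1 n.+1) (shape T).
  apply/allP=> k kT; rewrite mem_index_iota ltnS -Tn sumn_ge // andbT lt0n.
  by apply: contraNneq T0 => <-.
elim: (shape T) => [_|a s IH /= /andP[ain /IH IHs]].
  by rewrite big_nil big1.
rewrite big_cons -IHs (bigD1_seq a) ?iota_uniq //= [in RHS](bigD1_seq a) ?iota_uniq //=.
rewrite eqxx exprD expr1 -!mulrA; congr (_ * (_ * _)).
by apply: eq_bigr => i; rewrite eq_sym => /negPf->.
Qed.

(** Spreads the power of y of the theorem over the rows of the tableau, whose
    lengths add up to [n]. *)
Lemma prod_monomial (R : comNzRingType) (f : nat -> R) (y b : R) s :
  \prod_(k <- s) (f k * (y ^+ k * b)) =
  \prod_(k <- s) f k * (y ^+ sumn s * b ^+ size s).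
Proof.
elim: s => [|a s IH]; first by rewrite !big_nil !mulr1.
by rewrite !big_cons IH /= exprD exprS; ring.
Qed.

(* The polynomial identities are stated at every nonzero x of every field F   *)
(* of characteristic 0 in which x has a square root y; the formal identity is *)
(* the case F = Q(y), with y an indeterminate.                                *)
Theorem theorem48 (F : fieldType) (charF : [pchar F] =i pred0)
    (x y : F) (x_neq0 : x != 0) (y_sqrt : y ^+ 2 = x)
    (n : nat) (n_gt0 : (0 < n)%N) :
  (n.+1)`!%:R * (narayanaA F n).[x] =
    \sum_(T : SYT n)
      (\prod_(1 <= i < n.+1) (sigma T i)%:R) *
      (\prod_(1 <= i < n.+1) factorA y i ^+ w i T) *
      y ^ (n%:Z - (2 * nb_rows T)%N%:Z)
  /\
  n`!%:R * (narayanaB F n).[x] =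
    \sum_(T : SYT n)
      (\prod_(1 <= i < n.+1) ((delta T i)%:R * factorB x y i ^+ w i T)) *
      y ^ (n%:Z - (nb_rows T)%:Z).
Proof.
have y_neq0 : y != 0.
  by apply: contraNneq x_neq0 => y0; rewrite -y_sqrt y0 expr0n.
have yzE (m : nat) : y ^ (n%:Z - m%:Z) = y ^+ n * y^-1 ^+ m.
  by rewrite expfzDr // -exprnP -exprnN exprVn.
have at1_term m (g : nat -> {mpoly F[2]}) T : at1 (g 0%N) = 1 ->
    at1 (tower_term m g n T) =
    \prod_(k <- shape T) at1 (g k).
  move=> g0; rewrite /tower_term /at1 rmorphM rmorph_prod rmorphXn /= -/(at1 _) g0.
  by rewrite expr1n mul1r.
split.
  rewrite (narayanaA_flow charF y_sqrt n_gt0).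
  rewrite (iter_tower (flowM x) (ltnSn 0) (flow_towerA charF y_neq0 y_sqrt)
    sigma_grow_lt sigma_grow).
  rewrite /at1 raddf_sum (sum_SYT n (fun T =>
    \prod_(1 <= i < n.+1) (sigma T i)%:R * \prod_(1 <= i < n.+1) factorA y i ^+ w i T
    * y ^ (n%:Z - (2 * nb_rows T)%N%:Z))).
  apply: eq_big_seq => T; rewrite mem_syts => Tn.
  have [_ T0 sT _] := syt_props Tn.
  rewrite raddfMn /= -/(at1 _) -mulr_natl natr_prod -mulrA; congr (_ * _).
  rewrite (prod_row_lengths _ Tn) yzE exprM at1_term ?at1_towerA0 //.
  rewrite /nb_rows -[in RHS]sT -(size_map size T) -prod_monomial.
  apply: eq_big_seq => -[|k] kT; first by rewrite kT in T0.
  by rewrite at1_towerAS factorAE // exprVn; ring.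
rewrite (narayanaB_flow x).
rewrite (iter_tower (flowM x) (ltnW (ltnSn 1)) (flow_towerB x) delta_grow_lt delta_grow).
rewrite /at1 raddf_sum (sum_SYT n (fun T =>
  \prod_(1 <= i < n.+1) ((delta T i)%:R * factorB x y i ^+ w i T)
  * y ^ (n%:Z - (nb_rows T)%:Z))).
apply: eq_big_seq => T; rewrite mem_syts => Tn.
have [_ T0 sT _] := syt_props Tn.
rewrite raddfMn /= -/(at1 _) -mulr_natl natr_prod big_split /= -mulrA; congr (_ * _).
have b0 : at1 (towerB x 0) = 1 by rewrite at1_towerB mulr1.
rewrite (prod_row_lengths _ Tn) yzE at1_term //.
rewrite /nb_rows -[in RHS]sT -(size_map size T) -prod_monomial.
apply: eq_bigr => k _; have -> : y ^+ k = y ^+ odd k * x ^+ k./2.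
  by rewrite -{1}(odd_double_half k) exprD -mul2n exprM y_sqrt.
by rewrite at1_towerB /factorB exprMn; case: (odd k) => /=; field.
Qed.
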